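(* Equipped with the maps $\Psi_{G,H}$ and $\Psi_\bullet$ defined in the context, the functor $U\Upsilon^{\diamond}$ is a strong symmetric monoidal functor from $(\mathfrak R,\blacksquare,\check V^{\diamond}(\{1\}))$ (with unitors $\check\rho,\check\lambda$, associator $\check\alpha$, symmetry $\check\gamma$) to $(\mathfrak M,\Box,V^{\diamond}(\{1\}))$ (with unitors $r,\ell$, associator $a$, symmetry $c$).
   Context: Incidence hypergraphs: $G=(\check V(G),\check E(G),I(G),\varsigma_G:I(G)\to\check V(G),\omega_G:I(G)\to\check E(G))$; homomorphisms are triples of functions commuting with $\varsigma,\omega$; category $\mathfrak R$. Laplacian product: $\check V(G\blacksquare H)=(\{1\}\times\check V(G)\times\check V(H))\cup(\{4\}\times\check E(G)\times\check E(H))$, $\check E(G\blacksquare H)=(\{2\}\times\check E(G)\times\check V(H))\cup(\{3\}\times\check V(G)\times\check E(H))$, $I(G\blacksquare H)=(\{1\}\times I(G)\times\check V(H))\cup(\{2\}\times I(G)\times\check E(H))\cup(\{3\}\times\check E(G)\times I(H))\cup(\{4\}\times\check V(G)\times I(H))$, $\varsigma(1,x,y)=(1,\varsigma_G x,y)$, $\varsigma(2,x,y)=(4,\omega_G x,y)$, $\varsigma(3,x,y)=(4,x,\omega_H y)$, $\varsigma(4,x,y)=(1,x,\varsigma_H y)$, $\omega(1,x,y)=(2,\omega_G x,y)$, $\omega(2,x,y)=(3,\varsigma_G x,y)$, $\omega(3,x,y)=(2,x,\varsigma_H y)$, $\omega(4,x,y)=(3,x,\omega_H y)$; on morphisms componentwise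 (vertex-type components via $\check V$, edge-type via $\check E$, incidence-type via $I$). Unit $\check V^\diamond(\{1\})$: one vertex $1$, nothing else. Structure maps: $\check\rho_G:G\blacksquare\check V^\diamond(\{1\})\to G$: $(1,v,1)\mapsto v$, $(2,e,1)\mapsto e$, $(1,i,1)\mapsto i$; $\check\lambda_G:\check V^\diamond(\{1\})\blacksquare G\to G$: $(1,1,v)\mapsto v$, $(3,1,e)\mapsto e$, $(4,1,i)\mapsto i$; $\check\gamma_{G,H}:G\blacksquare H\to H\blacksquare G$: vertices $(n,x,y)\mapsto(n,y,x)$, edges and incidences $(n,x,y)\mapsto(5-n,y,x)$; $\check\alpha_{G,H,K}:(G\blacksquare H)\blacksquare K\to G\blacksquare(H\blacksquare K)$: vertices $(1,(1,v,w),u)\mapsto(1,v,(1,w,u))$, $(1,(4,e,f),u)\mapsto(4,e,(2,f,u))$, $(4,(2,e,w),g)\mapsto(4,e,(3,w,g))$, $(4,(3,v,f),g)\mapsto(1,v,(4,f,g))$; edges $(2,(2,e,w),u)\mapsto(2,e,(1,w,u))$, $(2,(3,v,f),u)\mapsto(3,v,(2,f,u))$, $(3,(1,v,w),g)\mapsto(3,v,(3,w,g))$, $(3,(4,e,f),g)\mapsto(2,e,(4,f,g))$; incidences $(1,(1,i,w),u)\mapsto(1,i,(1,w,u))$, $(1,(2,i,f),u)\mapsto(2,i,(2,f,u))$, $(1,(3,e,j),u)\mapsto(3,e,(3,j,u))$, $(1,(4,v,j),u)\mapsto(4,v,(4,j,u))$, $(2,(1,i,w),g)\mapsto(2,i,(3,w,g))$,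 $(2,(2,i,f),g)\mapsto(1,i,(4,f,g))$, $(2,(3,e,j),g)\mapsto(3,e,(2,j,g))$, $(2,(4,v,j),g)\mapsto(4,v,(2,j,g))$, $(3,(2,e,w),k)\mapsto(3,e,(4,w,k))$, $(3,(3,v,f),k)\mapsto(4,v,(3,f,k))$, $(4,(1,v,w),k)\mapsto(4,v,(4,w,k))$, $(4,(4,e,f),k)\mapsto(3,e,(3,f,k))$. Multigraphs: a multigraph $G$ is $(V(G),E(G),\epsilon_G)$ with $\epsilon_G:E(G)\to\mathcal P V(G)$ and $1\le|\epsilon_G(e)|\le 2$ for all $e$; a homomorphism $\phi$ is a pair of functions $V(\phi),E(\phi)$ with $\epsilon_H(E(\phi)(e))=V(\phi)[\epsilon_G(e)]$; category $\mathfrak M$. Box product: $V(G\Box H)=V(G)\times V(H)$, $E(G\Box H)=(\{1\}\times E(G)\times V(H))\cup(\{2\}\times V(G)\times E(H))$, $\epsilon(1,x,y)=\epsilon_G(x)\times\{y\}$, $\epsilon(2,x,y)=\{x\}\times\epsilon_H(y)$; $(\phi\Box\psi)$ acts by $(v,w)\mapsto(V\phi(v),V\psi(w))$, $(1,x,y)\mapsto(1,E\phi(x),V\psi(y))$, $(2,x,y)\mapsto(2,V\phi(x),E\psi(y))$. Unit $V^\diamond(\{1\})$: one vertex $1$, no edges. Structure maps: $r_G(v,1)=v$, $r_G(1,e,1)=e$; $\ell_G(1,v)=v$, $\ell_G(2,1,e)=e$; $c_{G,H}(v,w)=(w,v)$, $c_{G,H}(n,x,y)=(3-n,y,x)$;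 $a_{G,H,K}((v,w),u)=(v,(w,u))$, $a(1,(1,e,w),u)=(1,e,(w,u))$, $a(1,(2,v,f),u)=(2,v,(1,f,u))$, $a(2,(v,w),g)=(2,v,(2,w,g))$. The functor $U\Upsilon^\diamond:\mathfrak R\to\mathfrak M$ (bipartite incidence graph): $V(U\Upsilon^\diamond G)=(\{1\}\times\check V(G))\cup(\{2\}\times\check E(G))$, $E(U\Upsilon^\diamond G)=I(G)$, $\epsilon(i)=\{(1,\varsigma_G(i)),(2,\omega_G(i))\}$; on morphisms $(1,v)\mapsto(1,\check V\phi(v))$, $(2,e)\mapsto(2,\check E\phi(e))$, $i\mapsto I\phi(i)$. Structure maps: $\Psi_{G,H}:U\Upsilon^\diamond(G)\Box U\Upsilon^\diamond(H)\to U\Upsilon^\diamond(G\blacksquare H)$ with $V(\Psi)((1,v),(1,w))=(1,(1,v,w))$, $V(\Psi)((2,e),(1,w))=(2,(2,e,w))$, $V(\Psi)((1,v),(2,f))=(2,(3,v,f))$, $V(\Psi)((2,e),(2,f))=(1,(4,e,f))$, $E(\Psi)(1,i,(1,w))=(1,i,w)$, $E(\Psi)(1,i,(2,f))=(2,i,f)$, $E(\Psi)(2,(1,v),j)=(4,v,j)$, $E(\Psi)(2,(2,e),j)=(3,e,j)$; and $\Psi_\bullet:V^\diamond(\{1\})\to U\Upsilon^\diamond(\check V^\diamond(\{1\}))$ with $V(\Psi_\bullet)(1)=(1,1)$. Strong symmetric monoidal means: $\Psi$ is natural, $\Psi_{G,H}$ and $\Psi_\bullet$ are isomorphisms, and the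 standard associativity, left/right unitality and symmetry coherence diagrams commute.
   Formalization: The associator's values on the incidences (1,(3,e,j),u) and (1,(4,v,j),u), printed as (3,e,(3,j,u)) and (4,v,(4,j,u)), which are not incidences of the target product, are corrected to (3,e,(1,j,u)) and (4,v,(1,j,u)). *)

(* Defs.v *)
From mathcomp Require Import all_boot.
From mathcomp Require Import boolp classical_sets functions cardinality.

Set Implicit Arguments.
Unset Strict Implicit.
Unset Printing Implicit Defensive.

Local Open Scope classical_set_scope.
Local Open Scope card_scope.

Record category := Category {
  obj :> Type;
  hom : obj -> obj -> Type;
  idm : forall X, hom X X;
  compm : forall X Y Z, hom Y Z -> hom X Y -> hom X Z;
  compm1 : forall X Y (f : hom X Y), compm f (idm X) = f;
  comp1m : forall X Y (f : hom X Y), compm (idm Y) f = f;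
  compmA : forall W X Y Z (h : hom Y Z) (g : hom X Y) (f : hom W X),
    compm h (compm g f) = compm (compm h g) f }.

Arguments hom {c} X Y.
Arguments idm {c} X.
Arguments compm {c X Y Z} g f.

Declare Scope cat_scope.
Delimit Scope cat_scope with cat.
Local Open Scope cat_scope.

Notation "g \c f" := (compm g f) (at level 50, left associativity) : cat_scope.

Definition is_iso (C : category) (X Y : C) (f : hom X Y) : Prop :=
  exists g : hom Y X, g \c f = idm X /\ f \c g = idm Y.

Record functor (C D : category) := Functor {
  fobj :> C -> D;
  fmap : forall X Y : C, hom X Y -> hom (fobj X) (fobj Y);
  fmap1 : forall X : C, fmap (idm X) = idm (fobj X);
  fmapM : forall (X Y Z : C) (g : hom Y Z) (f : hom X Y),
    fmap (g \c f) = fmap g \c fmap f }.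

Record symMonCat := SymMonCat {
  smcat :> category;
  munit : smcat;
  mtensor : smcat -> smcat -> smcat;
  mtensorm : forall X X' Y Y' : smcat,
    hom X X' -> hom Y Y' -> hom (mtensor X Y) (mtensor X' Y');
  massoc : forall X Y Z : smcat,
    hom (mtensor (mtensor X Y) Z) (mtensor X (mtensor Y Z));
  mlunit : forall X : smcat, hom (mtensor munit X) X;
  mrunit : forall X : smcat, hom (mtensor X munit) X;
  msym : forall X Y : smcat, hom (mtensor X Y) (mtensor Y X);
  mtensorm1 : forall X Y : smcat,
    mtensorm (idm X) (idm Y) = idm (mtensor X Y);
  mtensormM : forall (X X' X'' Y Y' Y'' : smcat)
      (f' : hom X' X'') (f : hom X X') (g' : hom Y' Y'') (g : hom Y Y'),
    mtensorm (f' \c f) (g' \c g) = mtensorm f' g' \c mtensorm f g;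
  massoc_nat : forall (X X' Y Y' Z Z' : smcat)
      (f : hom X X') (g : hom Y Y') (h : hom Z Z'),
    massoc X' Y' Z' \c mtensorm (mtensorm f g) h
    = mtensorm f (mtensorm g h) \c massoc X Y Z;
  mlunit_nat : forall (X X' : smcat) (f : hom X X'),
    mlunit X' \c mtensorm (idm munit) f = f \c mlunit X;
  mrunit_nat : forall (X X' : smcat) (f : hom X X'),
    mrunit X' \c mtensorm f (idm munit) = f \c mrunit X;
  msym_nat : forall (X X' Y Y' : smcat) (f : hom X X') (g : hom Y Y'),
    msym X' Y' \c mtensorm f g = mtensorm g f \c msym X Y;
  massoc_iso : forall X Y Z, is_iso (massoc X Y Z);
  mlunit_iso : forall X, is_iso (mlunit X);
  mrunit_iso : forall X, is_iso (mrunit X);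
  msymK : forall X Y, msym Y X \c msym X Y = idm (mtensor X Y);
  mtriangle : forall X Y : smcat,
    mtensorm (idm X) (mlunit Y) \c massoc X munit Y
    = mtensorm (mrunit X) (idm Y);
  mpentagon : forall W X Y Z : smcat,
    massoc W X (mtensor Y Z) \c massoc (mtensor W X) Y Z
    = mtensorm (idm W) (massoc X Y Z) \c massoc W (mtensor X Y) Z
      \c mtensorm (massoc W X Y) (idm Z);
  mhexagon : forall X Y Z : smcat,
    massoc Y Z X \c msym X (mtensor Y Z) \c massoc X Y Z
    = mtensorm (idm Y) (msym X Z) \c massoc Y X Z
      \c mtensorm (msym X Y) (idm Z) }.

Arguments munit {s}.
Arguments mtensor {s} X Y.
Arguments mtensorm {s X X' Y Y'} f g.
Arguments massoc {s} X Y Z.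
Arguments mlunit {s} X.
Arguments mrunit {s} X.
Arguments msym {s} X Y.

Notation "X \ox Y" := (mtensor X Y)
  (at level 40, left associativity) : cat_scope.
Notation "f \oxm g" := (mtensorm f g)
  (at level 40, left associativity) : cat_scope.

Record strong_symmetric_monoidal (C D : symMonCat) (F : functor C D)
    (mu : forall X Y : C, hom (F X \ox F Y) (F (X \ox Y)))
    (mu0 : hom munit (F munit)) : Prop := StrongSymmetricMonoidal {
  ssm_nat : forall (X X' Y Y' : C) (f : hom X X') (g : hom Y Y'),
    mu X' Y' \c (fmap F f \oxm fmap F g) = fmap F (f \oxm g) \c mu X Y;
  ssm_iso : forall X Y : C, is_iso (mu X Y);
  ssm_iso0 : is_iso mu0;
  ssm_assoc : forall X Y Z : C,
    fmap F (massoc X Y Z) \c mu (X \ox Y) Z \c (mu X Y \oxm idm (F Z))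
    = mu X (Y \ox Z) \c (idm (F X) \oxm mu Y Z) \c massoc (F X) (F Y) (F Z);
  ssm_lunit : forall X : C,
    fmap F (mlunit X) \c mu munit X \c (mu0 \oxm idm (F X)) = mlunit (F X);
  ssm_runit : forall X : C,
    fmap F (mrunit X) \c mu X munit \c (idm (F X) \oxm mu0) = mrunit (F X);
  ssm_sym : forall X Y : C,
    fmap F (msym X Y) \c mu X Y = mu Y X \c msym (F X) (F Y) }.

(* [ivport] is varsigma and [ieport] is omega. *)
Record incHypergraph := IncHypergraph {
  ivert : Type;
  iedge : Type;
  inc : Type;
  ivport : inc -> ivert;
  ieport : inc -> iedge }.

Arguments ivport {i} _.
Arguments ieport {i} _.

Record incHom (G H : incHypergraph) := IncHom {
  ihV : ivert G -> ivert H;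
  ihE : iedge G -> iedge H;
  ihI : inc G -> inc H;
  ihvP : forall i, ivport (ihI i) = ihV (ivport i);
  iheP : forall i, ieport (ihI i) = ihE (ieport i) }.

Lemma incHom_eq (G H : incHypergraph) (f g : incHom G H) :
  ihV f =1 ihV g -> ihE f =1 ihE g -> ihI f =1 ihI g -> f = g.
Proof.
case: f g => [fV fE fI p q] [gV gE gI p' q'] /= /funext eV /funext eE /funext eI.
move: p q p' q'; rewrite eV eE eI => p q p' q'.
by congr IncHom; apply: Prop_irrelevance.
Qed.

Definition inc_id (G : incHypergraph) : incHom G G :=
  @IncHom G G id id id (fun=> erefl) (fun=> erefl).

Definition inc_comp (G H K : incHypergraph) (g : incHom H K) (f : incHom G H) :
  incHom G K.
Proof.
refine (@IncHom G K (ihV g \o ihV f) (ihE g \o ihE f) (ihI g \o ihI f) _ _).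
- by move=> i /=; rewrite ihvP ihvP.
- by move=> i /=; rewrite iheP iheP.
Defined.

Definition incCat : category.
Proof.
refine (@Category incHypergraph incHom inc_id inc_comp _ _ _);
  by move=> *; apply: incHom_eq.
Defined.

(* The Laplacian product. The number in a constructor name is the tag of the
   corresponding summand: [LV4 e f] is the vertex (4, e, f). *)
Inductive lapV (G H : incHypergraph) :=
  | LV1 of ivert G & ivert H
  | LV4 of iedge G & iedge H.
Inductive lapE (G H : incHypergraph) :=
  | LE2 of iedge G & ivert H
  | LE3 of ivert G & iedge H.
Inductive lapI (G H : incHypergraph) :=
  | LI1 of inc G & ivert H
  | LI2 of inc G & iedge H
  | LI3 of iedge G & inc H
  | LI4 of ivert G & inc H.

Arguments LV1 {G H} _ _.
Arguments LV4 {G H} _ _.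
Arguments LE2 {G H} _ _.
Arguments LE3 {G H} _ _.
Arguments LI1 {G H} _ _.
Arguments LI2 {G H} _ _.
Arguments LI3 {G H} _ _.
Arguments LI4 {G H} _ _.

Definition lap (G H : incHypergraph) : incHypergraph :=
  @IncHypergraph (lapV G H) (lapE G H) (lapI G H)
    (fun i => match i with
       | LI1 x y => LV1 (ivport x) y
       | LI2 x y => LV4 (ieport x) y
       | LI3 x y => LV4 x (ieport y)
       | LI4 x y => LV1 x (ivport y)
       end)
    (fun i => match i with
       | LI1 x y => LE2 (ieport x) y
       | LI2 x y => LE3 (ivport x) y
       | LI3 x y => LE2 x (ivport y)
       | LI4 x y => LE3 x (ieport y)
       end).

Definition lapm (G G' H H' : incHypergraph) (f : incHom G G') (g : incHom H H') :
  incHom (lap G H) (lap G' H').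
Proof.
refine (@IncHom (lap G H) (lap G' H')
  (fun v => match v with
     | LV1 x y => LV1 (ihV f x) (ihV g y)
     | LV4 x y => LV4 (ihE f x) (ihE g y)
     end)
  (fun e => match e with
     | LE2 x y => LE2 (ihE f x) (ihV g y)
     | LE3 x y => LE3 (ihV f x) (ihE g y)
     end)
  (fun i => match i with
     | LI1 x y => LI1 (ihI f x) (ihV g y)
     | LI2 x y => LI2 (ihI f x) (ihE g y)
     | LI3 x y => LI3 (ihE f x) (ihI g y)
     | LI4 x y => LI4 (ihV f x) (ihI g y)
     end) _ _); by case=> x y /=; rewrite ?ihvP ?iheP.
Defined.

Definition inc_unit : incHypergraph :=
  @IncHypergraph unit void void (of_void unit) id.

Definition lap_runit (G : incHypergraph) : incHom (lap G inc_unit) G.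
Proof.
refine (@IncHom (lap G inc_unit) G
  (fun v => match v with LV1 v _ => v | LV4 _ f => of_void _ f end)
  (fun e => match e with LE2 e _ => e | LE3 _ f => of_void _ f end)
  (fun i => match i with
     | LI1 i _ => i
     | LI2 _ f => of_void _ f
     | LI3 _ j => of_void _ j
     | LI4 _ j => of_void _ j
     end) _ _); by case=> x [].
Defined.

Definition lap_lunit (G : incHypergraph) : incHom (lap inc_unit G) G.
Proof.
refine (@IncHom (lap inc_unit G) G
  (fun v => match v with LV1 _ v => v | LV4 e _ => of_void _ e end)
  (fun e => match e with LE2 e _ => of_void _ e | LE3 _ e => e end)
  (fun i => match i with
     | LI1 i _ => of_void _ i
     | LI2 i _ => of_void _ i
     | LI3 e _ => of_void _ e
     | LI4 _ i => i
     end) _ _); by case=> [] [].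
Defined.

Definition lap_sym (G H : incHypergraph) : incHom (lap G H) (lap H G).
Proof.
refine (@IncHom (lap G H) (lap H G)
  (fun v => match v with LV1 x y => LV1 y x | LV4 x y => LV4 y x end)
  (fun e => match e with LE2 x y => LE3 y x | LE3 x y => LE2 y x end)
  (fun i => match i with
     | LI1 x y => LI4 y x
     | LI2 x y => LI3 y x
     | LI3 x y => LI2 y x
     | LI4 x y => LI1 y x
     end) _ _); by case.
Defined.

Definition lap_assocV (G H K : incHypergraph)
    (v : ivert (lap (lap G H) K)) : ivert (lap G (lap H K)) :=
  match v with
  | LV1 (LV1 v w) u => LV1 v (LV1 w u : ivert (lap H K))
  | LV1 (LV4 e f) u => LV4 e (LE2 f u : iedge (lap H K))
  | LV4 (LE2 e w) g => LV4 e (LE3 w g : iedge (lap H K))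
  | LV4 (LE3 v f) g => LV1 v (LV4 f g : ivert (lap H K))
  end.

Definition lap_assocE (G H K : incHypergraph)
    (e : iedge (lap (lap G H) K)) : iedge (lap G (lap H K)) :=
  match e with
  | LE2 (LE2 e w) u => LE2 e (LV1 w u : ivert (lap H K))
  | LE2 (LE3 v f) u => LE3 v (LE2 f u : iedge (lap H K))
  | LE3 (LV1 v w) g => LE3 v (LE3 w g : iedge (lap H K))
  | LE3 (LV4 e f) g => LE2 e (LV4 f g : ivert (lap H K))
  end.

Definition lap_assocI (G H K : incHypergraph)
    (i : inc (lap (lap G H) K)) : inc (lap G (lap H K)) :=
  match i with
  | LI1 (LI1 i w) u => LI1 i (LV1 w u : ivert (lap H K))
  | LI1 (LI2 i f) u => LI2 i (LE2 f u : iedge (lap H K))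
  | LI1 (LI3 e j) u => LI3 e (LI1 j u : inc (lap H K))
  | LI1 (LI4 v j) u => LI4 v (LI1 j u : inc (lap H K))
  | LI2 (LI1 i w) g => LI2 i (LE3 w g : iedge (lap H K))
  | LI2 (LI2 i f) g => LI1 i (LV4 f g : ivert (lap H K))
  | LI2 (LI3 e j) g => LI3 e (LI2 j g : inc (lap H K))
  | LI2 (LI4 v j) g => LI4 v (LI2 j g : inc (lap H K))
  | LI3 (LE2 e w) k => LI3 e (LI4 w k : inc (lap H K))
  | LI3 (LE3 v f) k => LI4 v (LI3 f k : inc (lap H K))
  | LI4 (LV1 v w) k => LI4 v (LI4 w k : inc (lap H K))
  | LI4 (LV4 e f) k => LI3 e (LI3 f k : inc (lap H K))
  end.

Definition lap_assoc (G H K : incHypergraph) :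
  incHom (lap (lap G H) K) (lap G (lap H K)).
Proof.
refine (@IncHom (lap (lap G H) K) (lap G (lap H K))
  (@lap_assocV G H K) (@lap_assocE G H K) (@lap_assocI G H K) _ _); by case=> [] [].
Defined.

Lemma lap_assoc_iso (G H K : incHypergraph) :
  is_iso (lap_assoc G H K : @hom incCat _ _).
Proof.
pose g : incHom (lap G (lap H K)) (lap (lap G H) K) :=
  inc_comp (lapm (lap_sym H G) (inc_id K))
    (inc_comp (lap_sym K (lap H G))
      (inc_comp (lap_assoc K H G)
        (inc_comp (lapm (lap_sym H K) (inc_id G)) (lap_sym G (lap H K))))).
exists g; split; apply: incHom_eq.
- by case=> [] [].
- by case=> [] [].
- by case=> [] [].
- by case=> x [].
- by case=> x [].
- by case=> x [].
Qed.

Lemma lap_lunit_iso (G : incHypergraph) :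
  is_iso (lap_lunit G : @hom incCat _ _).
Proof.
pose gV (v : ivert G) : ivert (lap inc_unit G) := LV1 (tt : ivert inc_unit) v.
pose gE (e : iedge G) : iedge (lap inc_unit G) := LE3 (tt : ivert inc_unit) e.
pose gI (i : inc G) : inc (lap inc_unit G) := LI4 (tt : ivert inc_unit) i.
exists (@IncHom _ _ gV gE gI (fun=> erefl) (fun=> erefl)).
by split; apply: incHom_eq => //; case=> [] [].
Qed.

Lemma lap_runit_iso (G : incHypergraph) :
  is_iso (lap_runit G : @hom incCat _ _).
Proof.
pose gV (v : ivert G) : ivert (lap G inc_unit) := LV1 v (tt : ivert inc_unit).
pose gE (e : iedge G) : iedge (lap G inc_unit) := LE2 e (tt : ivert inc_unit).
pose gI (i : inc G) : inc (lap G inc_unit) := LI1 i (tt : ivert inc_unit).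
exists (@IncHom _ _ gV gE gI (fun=> erefl) (fun=> erefl)).
by split; apply: incHom_eq => //; case=> x [].
Qed.

Definition incSMC : symMonCat.
Proof.
refine (@SymMonCat incCat inc_unit lap lapm lap_assoc lap_lunit lap_runit
  lap_sym _ _ _ _ _ _ lap_assoc_iso lap_lunit_iso lap_runit_iso _ _ _ _).
- by move=> X Y; apply: incHom_eq; case.
- by move=> X X' X'' Y Y' Y'' f' f g' g; apply: incHom_eq; case.
- by move=> X X' Y Y' Z Z' f g h; apply: incHom_eq; case=> [] [].
- by move=> X X' f; apply: incHom_eq; case=> [] [].
- by move=> X X' f; apply: incHom_eq; case=> x [].
- by move=> X X' Y Y' f g; apply: incHom_eq; case.
- by move=> X Y; apply: incHom_eq; case.
- by move=> X Y; apply: incHom_eq; case=> [] [] x [].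
- by move=> W X Y Z; apply: incHom_eq; case=> [] [] [].
- by move=> X Y Z; apply: incHom_eq; case=> [] [].
Defined.

(* [`I_n] is {0, ..., n - 1} and [#<=] compares cardinals, so the last two fields
   say 1 <= |mends e| <= 2: an edge is a loop or has two distinct ends. *)
Record multigraph := Multigraph {
  mvert : Type;
  medge : Type;
  mends : medge -> set mvert;
  mends_ge1 : forall e, `I_1 #<= mends e;
  mends_le2 : forall e, mends e #<= `I_2 }.

Arguments mends {m} _.

Record multiHom (G H : multigraph) := MultiHom {
  mhV : mvert G -> mvert H;
  mhE : medge G -> medge H;
  mhP : forall e, mends (mhE e) = mhV @` mends e }.

Lemma multiHom_eq (G H : multigraph) (f g : multiHom G H) :
  mhV f =1 mhV g -> mhE f =1 mhE g -> f = g.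
Proof.
case: f g => [fV fE p] [gV gE p'] /= /funext eV /funext eE.
move: p p'; rewrite eV eE => p p'.
by congr MultiHom; apply: Prop_irrelevance.
Qed.

Definition multi_id (G : multigraph) : multiHom G G.
Proof.
by refine (@MultiHom G G id id _) => e; rewrite image_id.
Defined.

Definition multi_comp (G H K : multigraph) (g : multiHom H K)
  (f : multiHom G H) : multiHom G K.
Proof.
refine (@MultiHom G K (mhV g \o mhV f) (mhE g \o mhE f) _) => e /=.
by rewrite !mhP image_comp.
Defined.

Definition multiCat : category.
Proof.
refine (@Category multigraph multiHom multi_id multi_comp _ _ _);
  by move=> *; apply: multiHom_eq.
Defined.

Lemma card_ge1_neq0 (T : Type) (A : set T) : (`I_1 #<= A) <-> A !=set0.
Proof.
split=> [|[x Ax]].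
  case: (eqVneq A set0) => [->|/set0P//].
  by rewrite card_le0 => /eqP/seteqP[/(_ 0)] /(_ erefl).
rewrite -(card_le_eql (@card_set1 T x)).
by apply: subset_card_le => y ->.
Qed.

Lemma card_ge1_image (T U : Type) (f : T -> U) (A : set T) :
  `I_1 #<= A -> `I_1 #<= f @` A.
Proof.
by move=> /card_ge1_neq0[x Ax]; apply/card_ge1_neq0; exists (f x), x.
Qed.

Lemma card_le2_image (T U : Type) (f : T -> U) (A : set T) :
  A #<= `I_2 -> f @` A #<= `I_2.
Proof. exact/card_le_trans/card_image_le. Qed.

Lemma setX1_image (T U : Type) (A : set T) (y : U) :
  A `*` [set y] = (fun x => (x, y)) @` A.
Proof.
apply/seteqP; split=> [[x z] [/= Ax ->]|_ [x Ax <-]]; last by [].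
by exists x.
Qed.

Lemma set1X_image (T U : Type) (x : T) (B : set U) :
  [set x] `*` B = (fun y => (x, y)) @` B.
Proof.
apply/seteqP; split=> [[z y] [/= -> By]|_ [y By <-]]; last by [].
by exists y.
Qed.

Lemma card_ge1_set2 (T : Type) (x y : T) : `I_1 #<= [set x; y].
Proof. by apply/card_ge1_neq0; exists x; left. Qed.

Lemma card_le2_set2 (T : Type) (x y : T) : [set x; y] #<= `I_2.
Proof.
have -> : [set x; y] = (fun n => if n is 0 then x else y) @` `I_2.
  apply/seteqP; split=> [z [->|->]|_ [[|n] _ <-]].
  - by exists 0.
  - by exists 1.
  - by left.
  - by right.
exact: card_image_le.
Qed.

(* [BE1] and [BE2] are the tags 1 and 2 of the edges of the box product. *)
Inductive boxE (G H : multigraph) :=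
  | BE1 of medge G & mvert H
  | BE2 of mvert G & medge H.

Arguments BE1 {G H} _ _.
Arguments BE2 {G H} _ _.

Definition box_ends (G H : multigraph) (e : boxE G H) :
    set (mvert G * mvert H) :=
  match e with
  | BE1 x y => mends x `*` [set y]
  | BE2 x y => [set x] `*` mends y
  end.

Definition box (G H : multigraph) : multigraph.
Proof.
refine (@Multigraph (mvert G * mvert H)%type (boxE G H) (@box_ends G H) _ _).
- case=> x y /=; rewrite ?setX1_image ?set1X_image; apply: card_ge1_image;
    exact: mends_ge1.
- case=> x y /=; rewrite ?setX1_image ?set1X_image; apply: card_le2_image;
    exact: mends_le2.
Defined.

Definition boxm (G G' H H' : multigraph) (f : multiHom G G')
  (g : multiHom H H') : multiHom (box G H) (box G' H').
Proof.
refine (@MultiHom (box G H) (box G' H')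
  (fun v => (mhV f v.1, mhV g v.2))
  (fun e => match e with
     | BE1 x y => BE1 (mhE f x) (mhV g y)
     | BE2 x y => BE2 (mhV f x) (mhE g y)
     end) _).
by case=> x y /=; rewrite mhP ?setX1_image ?set1X_image !image_comp.
Defined.

Definition multi_unit : multigraph :=
  @Multigraph unit void (of_void _)
    (fun e => of_void _ e) (fun e => of_void _ e).

Definition box_runit (G : multigraph) : multiHom (box G multi_unit) G.
Proof.
refine (@MultiHom (box G multi_unit) G fst
  (fun e => match e with BE1 e _ => e | BE2 _ f => of_void _ f end) _).
case=> [e u|v []] /=.
by rewrite setX1_image image_comp image_id.
Defined.

Definition box_lunit (G : multigraph) : multiHom (box multi_unit G) G.
Proof.
refine (@MultiHom (box multi_unit G) G snd
  (fun e => match e with BE1 e _ => of_void _ e | BE2 _ e => e end) _).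
case=> [[]|u e] /=.
by rewrite set1X_image image_comp image_id.
Defined.

Definition box_sym (G H : multigraph) : multiHom (box G H) (box H G).
Proof.
refine (@MultiHom (box G H) (box H G) (fun v => (v.2, v.1))
  (fun e => match e with BE1 x y => BE2 y x | BE2 x y => BE1 y x end) _).
by case=> x y /=; rewrite setX1_image set1X_image image_comp.
Defined.

Definition box_assocE (G H K : multigraph) (e : medge (box (box G H) K)) :
    medge (box G (box H K)) :=
  match e with
  | BE1 (BE1 e w) u => BE1 e ((w, u) : mvert (box H K))
  | BE1 (BE2 v f) u => BE2 v (BE1 f u : medge (box H K))
  | BE2 (v, w) g => BE2 v (BE2 w g : medge (box H K))
  end.

Definition box_assoc (G H K : multigraph) :
  multiHom (box (box G H) K) (box G (box H K)).
Proof.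
refine (@MultiHom (box (box G H) K) (box G (box H K))
  (fun v => (v.1.1, (v.1.2, v.2))) (@box_assocE G H K) _).
case=> [[e w|v f] u|[v w] g] /=;
  by rewrite ?setX1_image ?set1X_image ?setX1_image ?set1X_image !image_comp.
Defined.

Lemma box_assoc_iso (G H K : multigraph) :
  is_iso (box_assoc G H K : @hom multiCat _ _).
Proof.
pose g : multiHom (box G (box H K)) (box (box G H) K) :=
  multi_comp (boxm (box_sym H G) (multi_id K))
    (multi_comp (box_sym K (box H G))
      (multi_comp (box_assoc K H G)
        (multi_comp (boxm (box_sym H K) (multi_id G)) (box_sym G (box H K))))).
exists g; split; apply: multiHom_eq.
- by case=> [] [].
- by case=> [] [].
- by case=> x [].
- by case=> x [].
Qed.

Lemma box_lunit_iso (G : multigraph) :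
  is_iso (box_lunit G : @hom multiCat _ _).
Proof.
pose gV (v : mvert G) : mvert (box multi_unit G) := (tt, v).
pose gE (e : medge G) : medge (box multi_unit G) :=
  BE2 (tt : mvert multi_unit) e.
have gP e : mends (gE e) = gV @` mends e by rewrite /= set1X_image.
by exists (MultiHom gP); split; apply: multiHom_eq => //; case=> [] [].
Qed.

Lemma box_runit_iso (G : multigraph) :
  is_iso (box_runit G : @hom multiCat _ _).
Proof.
pose gV (v : mvert G) : mvert (box G multi_unit) := (v, tt).
pose gE (e : medge G) : medge (box G multi_unit) :=
  BE1 e (tt : mvert multi_unit).
have gP e : mends (gE e) = gV @` mends e by rewrite /= setX1_image.
by exists (MultiHom gP); split; apply: multiHom_eq => //; case=> x [].
Qed.

Definition multiSMC : symMonCat.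
Proof.
refine (@SymMonCat multiCat multi_unit box boxm box_assoc box_lunit box_runit
  box_sym _ _ _ _ _ _ box_assoc_iso box_lunit_iso box_runit_iso _ _ _ _).
- by move=> X Y; apply: multiHom_eq; case.
- by move=> X X' X'' Y Y' Y'' f' f g' g; apply: multiHom_eq; case.
- by move=> X X' Y Y' Z Z' f g h; apply: multiHom_eq; case=> [] [].
- by move=> X X' f; apply: multiHom_eq; case=> [] [].
- by move=> X X' f; apply: multiHom_eq; case=> x [].
- by move=> X X' Y Y' f g; apply: multiHom_eq; case.
- by move=> X Y; apply: multiHom_eq; case.
- by move=> X Y; apply: multiHom_eq; case=> [] [] x [].
- by move=> W X Y Z; apply: multiHom_eq; case=> [] [] [].
- by move=> X Y Z; apply: multiHom_eq; case=> [] [].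
Defined.

(* The bipartite incidence graph: [inl] is the tag 1 of the vertices of G and
   [inr] the tag 2 of its edges. *)
Definition bip_ends (G : incHypergraph) (i : inc G) :
    set (ivert G + iedge G) :=
  [set inl (ivport i); inr (ieport i)].

Definition bip (G : incHypergraph) : multigraph :=
  @Multigraph (ivert G + iedge G)%type (inc G) (@bip_ends G)
    (fun=> card_ge1_set2 _ _) (fun=> card_le2_set2 _ _).

Lemma image_set2 (T U : Type) (f : T -> U) (x y : T) :
  f @` [set x; y] = [set f x; f y].
Proof. by rewrite image_setU !image_set1. Qed.

Definition bipm (G H : incHypergraph) (f : incHom G H) :
  multiHom (bip G) (bip H).
Proof.
refine (@MultiHom (bip G) (bip H)
  (fun v => match v with
     | inl v => inl (ihV f v)
     | inr e => inr (ihE f e)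
     end)
  (ihI f) _).
by move=> i /=; rewrite /bip_ends image_set2 ihvP iheP.
Defined.

Definition bipF : functor incSMC multiSMC.
Proof.
refine (@Functor incSMC multiSMC bip bipm _ _).
- by move=> G; apply: multiHom_eq => //; case.
- by move=> G H K g f; apply: multiHom_eq => //; case.
Defined.

Definition bip_muV (G H : incHypergraph) (v : mvert (box (bip G) (bip H))) :
    mvert (bip (lap G H)) :=
  match v with
  | (inl v, inl w) => inl (LV1 v w)
  | (inr e, inl w) => inr (LE2 e w)
  | (inl v, inr f) => inr (LE3 v f)
  | (inr e, inr f) => inl (LV4 e f)
  end.

Definition bip_muE (G H : incHypergraph) (e : medge (box (bip G) (bip H))) :
    medge (bip (lap G H)) :=
  match e with
  | BE1 i (inl w) => LI1 i w
  | BE1 i (inr f) => LI2 i f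
  | BE2 (inl v) j => LI4 v j
  | BE2 (inr e) j => LI3 e j
  end.

Definition bip_mu (G H : incHypergraph) :
  multiHom (box (bip G) (bip H)) (bip (lap G H)).
Proof.
refine (@MultiHom (box (bip G) (bip H)) (bip (lap G H))
  (@bip_muV G H) (@bip_muE G H) _).
case=> [i [w|f]|[v|e] j] /=;
  rewrite ?setX1_image ?set1X_image image_comp /bip_ends image_set2 //=;
  exact: setUC.
Defined.

Definition bip_mu0 : multiHom multi_unit (bip inc_unit).
Proof.
by refine (@MultiHom multi_unit (bip inc_unit)
  (fun v => inl v) (fun e => e) _); case.
Defined.

(* Main.v *)
Require Import Defs.
From mathcomp Require Import all_boot.
From mathcomp Require Import classical_sets functions.

Set Implicit Arguments.
Unset Strict Implicit.
Unset Printing Implicit Defensive.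

Local Open Scope classical_set_scope.

(** Call vertices of a hypergraph even and its edges odd. A vertex of the box product of two
    incidence graphs is a pair of parities; the Laplacian product files the pairs of even sum
    ([LV1], [LV4]) as vertices and those of odd sum ([LE2], [LE3]) as edges, and [LI1] to [LI4] list
    an incidence beside a vertex or an edge. So [bip_mu] merely relabels and is bijective, hence
    invertible by [multiHom_is_iso]. Since [multiHom_eq] ignores the incidence proofs, each
    coherence diagram reduces to a computation on tags. *)

(** The inverse functions preserve ends for free: the ends of [e], which is [mhE f (gE e)], are the
    [mhV f]-image of those of [gE e], and [gV] undoes this image. *)
Lemma multiHom_is_iso (G H : multigraph) (f : multiHom G H)
    (gV : mvert H -> mvert G) (gE : medge H -> medge G) :
  cancel (mhV f) gV -> cancel gV (mhV f) ->
  cancel (mhE f) gE -> cancel gE (mhE f) ->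
  is_iso (f : @hom multiCat _ _).
Proof.
move=> fVK gVK fEK gEK.
have gP e : mends (gE e) = gV @` mends e.
  rewrite -[in RHS](gEK e) mhP image_comp -[LHS]image_id.
  by apply: eq_imagel => v _ /=; rewrite fVK.
by exists (MultiHom gP); split; apply: multiHom_eq.
Qed.

Definition bip_mu_invV (G H : incHypergraph) (v : mvert (bip (lap G H))) :
    mvert (box (bip G) (bip H)) :=
  match v with
  | inl (LV1 v w) => (inl v, inl w)
  | inr (LE2 e w) => (inr e, inl w)
  | inr (LE3 v f) => (inl v, inr f)
  | inl (LV4 e f) => (inr e, inr f)
  end.

Definition bip_mu_invE (G H : incHypergraph) (i : medge (bip (lap G H))) :
    medge (box (bip G) (bip H)) :=
  match i with
  | LI1 i w => @BE1 (bip G) (bip H) i (inl w)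
  | LI2 i f => @BE1 (bip G) (bip H) i (inr f)
  | LI3 e j => @BE2 (bip G) (bip H) (inr e) j
  | LI4 v j => @BE2 (bip G) (bip H) (inl v) j
  end.

Lemma bip_mu_iso (G H : incHypergraph) :
  is_iso (bip_mu G H : @hom multiCat _ _).
Proof.
apply: (@multiHom_is_iso _ _ _ (@bip_mu_invV G H) (@bip_mu_invE G H)).
- by case=> [] [] x [].
- by case=> [] [].
- by case=> [x []|[]].
- by case.
Qed.

Lemma bip_mu0_iso : is_iso (bip_mu0 : @hom multiCat _ _).
Proof.
(* [id] serves on edges because both edge types are [void]. *)
apply: (@multiHom_is_iso multi_unit (bip inc_unit) bip_mu0
  (fun v => match v with inl u => u | inr e => of_void _ e end) id) => //.
by case=> [] [].
Qed.

Theorem mainTheorem5 :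
  @strong_symmetric_monoidal incSMC multiSMC bipF bip_mu bip_mu0.
Proof.
split.
- move=> G G' H H' f g; apply: multiHom_eq.
  + by case=> [] [] x [].
  + by case=> [x []|[]].
- exact: bip_mu_iso.
- exact: bip_mu0_iso.
- move=> G H K; apply: multiHom_eq.
  + by case=> [] [] [] x [] y [].
  (* These twelve cases are the twelve clauses of [lap_assocI]. *)
  + by case=> [[i [w|f]|[v|e] j] [u|g]|[[v|e] [w|f]] k].
- move=> G; apply: multiHom_eq.
  + by case=> [] [] [].
  + by case=> [] [].
- move=> G; apply: multiHom_eq.
  + by case=> [] [] x [].
  + by case=> x [].
- move=> G H; apply: multiHom_eq.
  + by case=> [] [] x [].
  + by case=> [x []|[]].
Qed.
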